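(* Let $N\ge3$ be an integer. Then the ideal $$(x_0^N,\ x_1^N,\ x_2^N,\ x_3^N,\ (x_0+x_1+x_2+x_3)^N)\subset\mathbb{C}[x_0,x_1,x_2,x_3]$$ fails the WLP in degree $2N-3$.
   Context: For an artinian homogeneous ideal $I$ in a polynomial ring $R$ over $\mathbb{C}$, put $A=R/I=\bigoplus_jA_j$. $I$ fails the WLP (Weak Lefschetz Property) in degree $j$ if for every linear form $L$ the multiplication map $\times L:A_j\to A_{j+1}$ does not have maximal rank (i.e. is neither injective nor surjective). *)

(* Defs.v *)
From HB Require Import structures.
From mathcomp Require Import all_boot all_order all_algebra.
From mathcomp Require Export mathcomp_extra boolp classical_sets functions.
From mathcomp Require Export reals complex mpoly.

Set Implicit Arguments.
Unset Strict Implicit.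
Unset Printing Implicit Defensive.

Import GRing.Theory.
Local Open Scope ring_scope.
Local Open Scope quotient_scope.

Section IdealQuotient.
Variables (R : comNzRingType) (gens : seq R).

Definition gen_ideal : {pred R} := fun p =>
  `[< exists c : 'I_(size gens) -> R, p = \sum_i c i * gens`_i >].

Lemma gen_ideal_zmod_closed : zmod_closed gen_ideal.
Proof.
split=> [|p q /asboolP[c ->] /asboolP[d ->]]; apply/asboolP.
  by exists (fun=> 0); rewrite big1 // => i _; rewrite mul0r.
exists (fun i => c i - d i); rewrite -sumrB.
by apply: eq_bigr => i _; rewrite mulrBl.
Qed.

HB.instance Definition _ := GRing.isZmodClosed.Build R gen_ideal
  gen_ideal_zmod_closed.

Lemma gen_idealMl (a p : R) : p \in gen_ideal -> a * p \in gen_ideal.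
Proof.
move=> /asboolP[c ->]; apply/asboolP; exists (fun i => a * c i).
by rewrite mulr_sumr; apply: eq_bigr => i _; rewrite mulrA.
Qed.

(* The library's quotient ring {ideal_quot _} only exists for proper ideals;
   this is the underlying quotient group, with the action of R on it given by
   [quot_mul]. *)
Definition quot_by : zmodType := Quotient.quot gen_ideal.

Definition quot_mul (a : R) : quot_by -> quot_by :=
  lift_op1 quot_by ( *%R a).

Lemma quot_mulE (a p : R) : quot_mul a (\pi_quot_by p) = \pi_quot_by (a * p).
Proof.
rewrite /quot_mul; unlock; apply/eqP; rewrite -Quotient.idealrBE -mulrBr.
by apply: gen_idealMl; rewrite Quotient.idealrBE reprK.
Qed.

End IdealQuotient.

Section WeakLefschetz.
Variables (K : fieldType) (n : nat) (gens : seq {mpoly K[n]}).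

Definition graded_part (j : nat) : set (quot_by gens) :=
  [set \pi_(quot_by gens) p | p in [set p : {mpoly K[n]} | p \is j.-homog]]%classic.

Definition max_rank (L : {mpoly K[n]}) (j : nat) : Prop :=
  set_inj (graded_part j) (quot_mul L) \/
  set_surj (graded_part j) (graded_part j.+1) (quot_mul L).

Definition fails_WLP (j : nat) : Prop :=
  forall L : {mpoly K[n]}, L \is 1.-homog -> ~ max_rank L j.

End WeakLefschetz.

(* Main.v *)
(* Let [l_0, ..., l_4] be the coordinates and their sum, and [I] the ideal of
   their [N]-th powers. For a linear form [L], some nonzero quadric [q] (10
   coefficients) satisfies [L(d) q = 0] (4 conditions) and [l_i(d)^2 q = 0]
   (5 conditions): if [L != 0], a conic through five points of a plane.
   Then [q^(N-1)] is killed by [L(d)] and by every [l_i(d)^N], so by apolarity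
   [(L) + I] misses part of degree [2N-2] and multiplication by [L] is not
   surjective. Injectivity would then force [dim A_(2N-3) < dim A_(2N-2)].
   In degree [2N-2] the five powers satisfy no syzygy: modulo the
   [x_i^N], multiplication by the sum of the coordinates is the raising operator
   of an sl2-representation, hence injective below the middle degree [2N-2].
   So the difference [dim A_(2N-2) - dim A_(2N-3)] is at most
   [C(2N,2) - 5 C(N,2) = N (3 - N) / 2 <= 0], a contradiction. *)
Require Import Defs.
From HB Require Import structures.
From mathcomp Require Import all_boot all_order all_algebra.
From mathcomp Require Import zify ring.
From mathcomp Require Import ssrcomplements.

Set Implicit Arguments.
Unset Strict Implicit.
Unset Printing Implicit Defensive.

Import GRing.Theory Num.Theory.
Local Open Scope ring_scope.
Local Open Scope quotient_scope.

(** * Dimension count *)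

(** By rank-nullity the preimage of [limg g] under [f] has dimension
    [dim U + dim W - \dim (limg f + limg g)], and [h] bounds it by [dim E]. *)
Lemma preim_limg_dim (K : fieldType) (U W V E : vectType K)
    (f : 'Hom(U, V)) (g : 'Hom(W, V)) (h : 'Hom(E, U)) :
    lker g == 0%VS -> (f @^-1: limg g <= limg h)%VS ->
    (limg f + limg g)%VS != fullv ->
  (dim U + dim W < dim V + dim E)%N.
Proof.
move=> kg0 sub nfull.
have dimD : (\dim (limg f + limg g) < dim V)%N.
  rewrite -dimvf ltn_neqAle dimvS ?subvf // andbT.
  by apply: contra nfull => /eqP e; rewrite eqEdim subvf e leqnn.
have dg : \dim (limg g) = dim W.
  have := limg_ker_dim g fullv.
  by move/eqP: kg0 => ->; rewrite capv0 dimv0 add0n dimvf => ->.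
have df : (\dim (lker f) + \dim (limg f))%N = dim U.
  by have := limg_ker_dim f fullv; rewrite capfv dimvf => ->.
have kP : (lker f <= f @^-1: limg g)%VS.
  by apply/subvP => u; rewrite memv_ker -memv_preim => /eqP->; rewrite mem0v.
have := limg_ker_dim f (f @^-1: limg g)%VS.
(* The preimage contains all of [lker f], and [f] maps it onto the intersection of the two
   images. *)
rewrite (capv_idPr kP) -lpreim_cap_limg (lpreimK (capvSr _ _)) lpreim_cap_limg.
have := dimv_sum_cap (limg f) (limg g); rewrite dg capvC.
have := dimvS sub.
have : (\dim (limg h) <= dim E)%N.
  by rewrite -dimvf -(limg_ker_dim h fullv) leq_addl.
lia.
Qed.

Lemma pihomogMr (n : nat) (K : nzRingType) (d e : nat) (p g : {mpoly K[n]}) :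
    g \is d.-homog ->
  pihomog mdeg (d + e) (p * g) = pihomog mdeg e p * g.
Proof.
move=> hg.
rewrite {1}(pihomog_partitionE (leqnn (mmeasure mdeg p))) mulr_suml raddf_sum.
transitivity (\sum_(k < mmeasure mdeg p)
    if k == e :> nat then pihomog mdeg e p * g else 0).
  apply: eq_bigr => k _; have hk := dhomogM (pihomogP mdeg k p) hg.
  rewrite addnC in hk; case: eqP => [<-|/eqP ne]; first exact: pihomog_dE hk.
  by apply: pihomog_ne0 hk; rewrite eqn_add2l.
have [lt|ge] := ltnP e (mmeasure mdeg p).
  rewrite (bigD1 (Ordinal lt)) //= eqxx big1 ?addr0 // => k ne.
  exact: ifN.
rewrite big1 => [|k _]; last by rewrite ltn_eqF // (leq_trans (ltn_ord k)).
rewrite pihomogE big_seq_cond big1 ?mul0r // => m /andP[ms /eqP hm].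
by have := leq_trans (mmeasure_mnm_lt mdeg ms) ge; rewrite hm ltnn.
Qed.

(** * Multiplication maps between graded pieces *)

Section HomogeneousMaps.
Variables (n : nat) (K : fieldType).

Definition hproj (d : nat) (p : {mpoly K[n.+1]}) : dhomog n.+1 K d :=
  DHomog (pihomogP mdeg d p).

Lemma val_hproj d p : p \is d.-homog -> val (hproj d p) = p.
Proof. exact: pihomog_dE. Qed.

(** Projecting makes the map total with [d] and [e] independent; on matching degrees the projection
    is the identity, by [val_hproj]. *)
Definition hmul (d e : nat) (p : {mpoly K[n.+1]}) (u : dhomog n.+1 K e) :
  dhomog n.+1 K d := hproj d (p * val u).

Lemma hmul_is_linear d e p : linear (@hmul d e p).
Proof.
move=> a u v; apply/val_inj; rewrite /= mulrDr -scalerAr.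
exact: linearP.
Qed.

HB.instance Definition _ d e p :=
  GRing.isLinear.Build K (dhomog n.+1 K e) (dhomog n.+1 K d) _ (@hmul d e p)
    (@hmul_is_linear d e p).

Definition hcomb (gens : seq {mpoly K[n.+1]}) (d e : nat)
    (c : {ffun 'I_(size gens) -> dhomog n.+1 K e}) : dhomog n.+1 K d :=
  hproj d (\sum_i val (c i) * gens`_i).

Lemma hcomb_is_linear gens d e : linear (@hcomb gens d e).
Proof.
move=> a u v; apply/val_inj; rewrite /=.
rewrite -[RHS]linearP scaler_sumr -big_split; congr (pihomog _ _ _).
apply: eq_bigr => i _.
by rewrite !ffunE /= mulrDl -scalerAl.
Qed.

HB.instance Definition _ gens d e :=
  GRing.isLinear.Build K {ffun 'I_(size gens) -> dhomog n.+1 K e}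
    (dhomog n.+1 K d) _ (@hcomb gens d e) (@hcomb_is_linear gens d e).

(** Coefficients may be replaced by their components of degree [e], since taking components commutes
    with multiplication by a form. *)
Lemma gen_ideal_homog (gens : seq {mpoly K[n.+1]}) (d e : nat) p :
    (forall i : 'I_(size gens), gens`_i \is d.-homog) ->
    p \is (d + e).-homog -> p \in gen_ideal gens ->
  exists c : {ffun 'I_(size gens) -> dhomog n.+1 K e},
    p = \sum_i val (c i) * gens`_i.
Proof.
move=> hg hp /asboolP[c pE]; exists [ffun i => hproj e (c i)].
rewrite -(pihomog_dE hp) pE raddf_sum; apply: eq_bigr => i _ /=.
by rewrite ffunE /= pihomogMr.
Qed.

(** The binomials are dimensions of graded pieces. The absence of syzygies fixes the dimension of
    the ideal in degree [(d + e).+1], in degree [d + e] it is bounded above, and [w] makes the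
    inequality strict. *)
Lemma injective_mul_dim (gens : seq {mpoly K[n.+1]}) (d e : nat)
    (L w : {mpoly K[n.+1]}) :
    (forall i : 'I_(size gens), gens`_i \is d.-homog) -> L \is 1.-homog ->
    (forall c : 'I_(size gens) -> {mpoly K[n.+1]},
      (forall i, c i \is e.+1.-homog) -> \sum_i c i * gens`_i = 0 ->
      forall i, c i = 0) ->
    (forall p, p \is (d + e).-homog -> L * p \in gen_ideal gens ->
      p \in gen_ideal gens) ->
    w \is (d + e).+1.-homog -> (forall p, w - L * p \notin gen_ideal gens) ->
  ('C(d + e + n, d + e) + size gens * 'C(e.+1 + n, e.+1) <
   'C((d + e).+1 + n, (d + e).+1) + size gens * 'C(e + n, e))%N.
Proof.
move=> hg hL free injL hw ncov.
have hsum j (c : {ffun 'I_(size gens) -> dhomog n.+1 K j}) :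
    \sum_i val (c i) * gens`_i \is (d + j).-homog.
  apply: rpred_sum => i _; rewrite addnC.
  exact: dhomogM (dhomog_is_dhomog _) (hg i).
have hmulL (u : dhomog n.+1 K (d + e)) : L * val u \is (d + e).+1.-homog.
  exact: dhomogM hL (dhomog_is_dhomog u).
have vsum (c : {ffun 'I_(size gens) -> dhomog n.+1 K e.+1}) :
    val (hcomb (d + e).+1 c) = \sum_i val (c i) * gens`_i.
  by apply: val_hproj; rewrite -addnS; apply: hsum.
pose f := linfun (@hmul (d + e).+1 (d + e) L).
pose g := linfun (@hcomb gens (d + e).+1 e.+1).
pose h := linfun (@hcomb gens (d + e) e).
have fE u : f u = hmul (d + e).+1 L u by rewrite /f lfunE.
have gE c : g c = hcomb (d + e).+1 c by rewrite /g lfunE.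
have hE c : h c = hcomb (d + e) c by rewrite /h lfunE.
have := @preim_limg_dim K _ _ _ _ f g h.
rewrite /dim /= card_ord; apply.
- apply/lker0P; apply: raddf_inj => c; rewrite /= gE => /(congr1 val).
  rewrite vsum => c0; apply/ffunP => i; apply/val_inj; rewrite ffunE /=.
  exact: free (fun i => dhomog_is_dhomog (c i)) c0 i.
- apply/subvP => u; rewrite -memv_preim fE => /memv_imgP[c _].
  rewrite gE => /(congr1 val); rewrite (val_hproj (hmulL u)) vsum => uE.
  have uI : val u \in gen_ideal gens.
    apply: injL (dhomog_is_dhomog u) _; rewrite uE; apply/asboolP.
    by exists (fun i => val (c i)).
  have [c' uE'] := gen_ideal_homog hg (dhomog_is_dhomog u) uI.
  apply/memv_imgP; exists c'; rewrite ?memvf // hE.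
  by apply/val_inj; rewrite val_hproj ?hsum.
- apply/negP => /eqP full; have : hproj (d + e).+1 w \in (limg f + limg g)%VS.
    by rewrite full memvf.
  case/memv_addP => _ /memv_imgP[u _ ->] [_ /memv_imgP[c _ ->]].
  rewrite fE gE => /(congr1 val); rewrite val_hproj //= => wE.
  have /negP := ncov (val u); apply; apply/asboolP.
  exists (fun i => val (c i)); rewrite wE.
  have /= -> := vsum c; rewrite (pihomog_dE (hmulL u)).
  by rewrite addrC addKr.
Qed.

End HomogeneousMaps.

(** * Multiplication by the sum of the variables modulo their powers *)

Section Lowering.
Variables (n : nat) (K : numFieldType) (N : nat).
Implicit Types p q : {mpoly K[n]}.

Lemma mcoeffMX_eq0 p (k m : 'X_{1..n}) :
  ~~ (k <= m)%MM -> (p * 'X_[k])@_m = 0.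
Proof.
move=> nle; apply/memN_msupp_eq0; rewrite (perm_mem (msuppMX _ _)).
by apply: contra nle => /mapP[m' _ ->]; apply: lem_addr.
Qed.

Lemma dhomog_coeff0 d p m : p \is d.-homog -> mdeg m != d -> p@_m = 0.
Proof. exact: dhomog_nemf_coeff. Qed.

Lemma mpolyX_homog i : ('X_i : {mpoly K[n]}) \is 1.-homog.
Proof. by rewrite dhomogX; apply/eqP/mdeg1. Qed.

Lemma mderivXU_mul i k p :
  ('X_k * p)^`M(i) = p *+ (k == i) + 'X_k * p^`M(i).
Proof.
rewrite mderivM mderivX mnm1E; case: eqVneq => [->|_].
  by rewrite scale1r -[X in (X - _)%MM]add0m addmK mpolyX0 mul1r.
by rewrite scale0r mul0r.
Qed.

Lemma mcoeff_euler i p (m : 'X_{1..n}) :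
  ('X_i * p^`M(i))@_m = p@_m *+ m i.
Proof.
have [m0|m_gt0] := posnP (m i).
  rewrite m0 mulr0n mulrC mcoeffMX_eq0 //.
  by apply/negP => /mnm_lepP /(_ i); rewrite mnm1E eqxx m0.
have le1 : (U_(i) <= m)%MM.
  by apply/mnm_lepP => j; rewrite mnm1E; case: eqVneq => [<-|].
rewrite -(submK le1) addmC mulrC mcoeffMX mcoeff_mderiv.
by rewrite [in RHS]addmC !mnmDE mnm1E eqxx addn1.
Qed.

Lemma euler_homog j p : p \is j.-homog ->
  \sum_i 'X_i * p^`M(i) = p *+ j.
Proof.
move=> hp; apply/mpolyP => m; rewrite raddf_sum mcoeffMn /=.
under eq_bigr do rewrite mcoeff_euler.
rewrite sumrMnr -mdegE.
have [<-//|ne] := eqVneq (mdeg m) j.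
by rewrite (dhomog_coeff0 hp ne) !mul0rn.
Qed.

Lemma mderiv_homog i j p : p \is j.+1.-homog -> p^`M(i) \is j.-homog.
Proof.
move=> hp; apply/dhomogP => m; rewrite mcoeff_msupp mcoeff_mderiv => nz.
apply: contraNeq nz => ne; rewrite (dhomog_coeff0 hp) ?mul0rn //.
by rewrite mdegD mdeg1 addn1 eqSS.
Qed.

(* [x^k |-> k (N - k) x^(k-1)] in each variable: the lowering operator of sl2
   for which multiplication by the sum of the variables is the raising one. *)
Definition lowering p := \sum_i (p *+ N - 'X_i * p^`M(i))^`M(i).

Lemma lowering_is_linear : linear lowering.
Proof.
move=> a p q; rewrite /lowering scaler_sumr -big_split; apply: eq_bigr => i _.
rewrite -[RHS]linearP; congr (_^`M(i)).
by rewrite linearP mulrnDl mulrDr opprD addrACA scalerBr -scalerAr scalerMnr.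
Qed.

HB.instance Definition _ :=
  GRing.isLinear.Build K {mpoly K[n]} {mpoly K[n]} _ lowering
    lowering_is_linear.

Lemma mcoeff_lowering p (m : 'X_{1..n}) :
  (lowering p)@_m = \sum_i p@_(m + U_(i)) * (N%:R - (m i).+1%:R) *+ (m i).+1.
Proof.
rewrite raddf_sum; apply: eq_bigr => i _ /=.
rewrite mcoeff_mderiv mcoeffB mcoeffMn mcoeff_euler mnmDE mnm1E eqxx addn1.
by congr (_ *+ _); ring.
Qed.

Lemma lowering_mulX k p :
  lowering ('X_k * p) =
  'X_k * lowering p + (p *+ N - p) - ('X_k * p^`M(k)) *+ 2.
Proof.
rewrite /lowering (bigD1 k) //= [in RHS](bigD1 k) //=.
set s := \sum_(i | i != k) (p *+ N - 'X_i * p^`M(i))^`M(i).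
rewrite (_ : \sum_(i | i != k) _ = 'X_k * s).
  rewrite !(mderivXU_mul, mderivB, mderivMn, mderivD) eqxx /=.
  ring.
rewrite [RHS]mulr_sumr; apply: eq_bigr => i /negPf ne.
rewrite !(mderivXU_mul, mderivB, mderivMn, mderivD) eqxx eq_sym ne /=.
ring.
Qed.

(** By Euler's formula, the commutator of lowering and raising acts on degree [j] as the sl2-weight
    [n * (N - 1) - 2 * j]. *)
Lemma lowering_mul_sumX j p : p \is j.-homog ->
  lowering ((\sum_i 'X_i) * p) =
  (\sum_i 'X_i) * lowering p + (p *+ N - p) *+ n - p *+ j.*2.
Proof.
move=> hp; rewrite mulr_suml raddf_sum /=.
under eq_bigr do rewrite lowering_mulX.
rewrite big_split /= big_split /= -mulr_suml sumr_const card_ord sumrN.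
by rewrite sumrMnl (euler_homog hp) -mulrnA muln2.
Qed.

Lemma lowering_homog j p : p \is j.+1.-homog -> lowering p \is j.-homog.
Proof.
move=> hp; apply: rpred_sum => i _; apply: mderiv_homog.
rewrite rpredB ?rpredMn // -add1n; apply: dhomogM; last exact: mderiv_homog.
exact: mpolyX_homog.
Qed.

Lemma lowering_homog0 p : p \is 0.-homog -> lowering p = 0.
Proof.
move=> hp; apply/mpolyP => m; rewrite mcoeff_lowering mcoeff0 big1 // => i _.
by rewrite (dhomog_coeff0 hp) ?mul0r ?mul0rn // mdegD mdeg1 addn1.
Qed.

(* Membership in the monomial ideal generated by the ['X_i ^+ N]. *)
Definition in_powers p :=
  forall m : 'X_{1..n}, (forall i, (m i < N)%N) -> p@_m = 0.

Lemma in_powersD p q : in_powers p -> in_powers q -> in_powers (p + q).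
Proof. by move=> hp hq m hm; rewrite mcoeffD hp // hq // addr0. Qed.

Lemma in_powersMnK p k : (0 < k)%N -> in_powers (p *+ k) -> in_powers p.
Proof.
move=> k_gt0 hp m hm; apply/eqP; move/eqP: (hp m hm).
by rewrite mcoeffMn mulrn_eq0 eqn0Ngt k_gt0.
Qed.

Lemma in_powersN p : in_powers p -> in_powers (- p).
Proof. by move=> hp m hm; rewrite mcoeffN hp // oppr0. Qed.

Lemma in_powers_mulXn i p : in_powers (p * 'X_i ^+ N).
Proof.
move=> m hm; rewrite mpolyXn mcoeffMX_eq0 //.
by apply/negP => /mnm_lepP /(_ i); rewrite mulmnE mnm1E eqxx mul1n leqNgt hm.
Qed.

Lemma in_powersM p q : in_powers q -> in_powers (p * q).
Proof.
move=> hq m hm; apply: contraTeq isT; rewrite -mcoeff_msupp.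
move/msuppM_le/allpairsP => [[m1 m2]] /= [_ m2q mE].
move: m2q; rewrite mcoeff_msupp hq ?eqxx // => i.
by apply: leq_ltn_trans (hm i); rewrite mE mnmDE leq_addl.
Qed.

(** An exponent can leave the range below [N] only from [m i = N - 1], and there the factor
    [N%:R - (m i).+1%:R] is zero. *)
Lemma in_powers_lowering p : in_powers p -> in_powers (lowering p).
Proof.
move=> hp m hm; rewrite mcoeff_lowering big1 // => i _.
have [lt|ge] := ltnP (m i).+1 N.
  rewrite hp ?mul0r ?mul0rn // => k; rewrite mnmDE mnm1E.
  by case: eqVneq => [<-|_]; rewrite ?addn1 // addn0.
suff -> : N = (m i).+1 by rewrite subrr mulr0 mul0rn.
by apply/eqP; rewrite eqn_leq ge hm.
Qed.

Lemma in_powers_small j p : (j < N)%N -> p \is j.-homog -> in_powers p -> p = 0.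
Proof.
move=> jN hp ip; apply/mpolyP => m; rewrite mcoeff0.
have [mj|ne] := eqVneq (mdeg m) j; last exact: dhomog_coeff0 hp ne.
apply: ip => i; apply: leq_ltn_trans jN; rewrite -mj mdegE (bigD1 i) //=.
exact: leq_addr.
Qed.

(* Modulo the ideal, [p] is an eigenvector of lowering after raising, with
   eigenvalue [- mu <= 0]; then so is [lowering p], with a negative eigenvalue
   [- mu'], and induction on the degree kills [lowering p], hence [p *+ mu']. *)
Lemma in_powers_lowering_sumX j mu p :
    (j.*2 < n * N.-1)%N -> p \is j.-homog ->
    in_powers (lowering ((\sum_i 'X_i) * p) + p *+ mu) ->
  in_powers p.
Proof.
elim: j mu p => [|j IHj] mu p lt hp; rewrite (lowering_mul_sumX hp).
  rewrite (lowering_homog0 hp) mulr0 add0r mulr0n subr0.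
  have -> : (p *+ N - p) *+ n + p *+ mu = p *+ (n * N.-1 + mu).
    have N0 : (0 < N)%N by lia.
    rewrite -[in LHS](prednK N0) mulrSr addrK -mulrnA -mulrnDr.
    by congr (_ *+ _); lia.
  by apply: in_powersMnK; rewrite addn_gt0 (leq_trans _ lt).
(* The weight of degree [j.+1] plus [mu]; [lt] makes the truncated subtraction exact and [mu']
   positive. *)
set mu' := (n * N.-1 - j.+1.*2 + mu)%N.
have -> q : q + (p *+ N - p) *+ n - p *+ j.+1.*2 + p *+ mu = q + p *+ mu'.
  rewrite -!addrA; congr (_ + _).
  have N0 : (0 < N)%N by lia.
  rewrite -[in LHS](prednK N0) mulrSr addrK -mulrnA addrA.
  rewrite -mulrnBr; last by lia.
  by rewrite -mulrnDr /mu'; congr (_ *+ _); lia.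
move=> h; have hl := lowering_homog hp.
have il : in_powers (lowering p).
  apply: (IHj mu') => //; first by lia.
  have := in_powers_lowering h; rewrite raddfD raddfMn; exact.
apply: (@in_powersMnK _ mu'); first by rewrite /mu'; lia.
rewrite -[X in in_powers X](addKr ((\sum_i 'X_i) * lowering p)).
by apply: in_powersD h; apply/in_powersN/in_powersM.
Qed.

Lemma in_powers_mul_sumX j p :
    (j.*2 < n * N.-1)%N -> p \is j.-homog ->
    in_powers ((\sum_i 'X_i) * p) ->
  in_powers p.
Proof.
move=> lt hp ip; apply: (in_powers_lowering_sumX (mu := 0) lt hp).
by rewrite mulr0n addr0; apply: in_powers_lowering.
Qed.

Lemma sumX_homog : \sum_(i < n) ('X_i : {mpoly K[n]}) \is 1.-homog.
Proof. by apply: rpred_sum => i _; exact: mpolyX_homog. Qed.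

(** The factors are cancelled one at a time; the first cancellation happens in the largest degree,
    [j + k.-1], so the bound is imposed there. *)
Lemma in_powers_mul_sumXn j k p :
    ((j + k.-1).*2 < n * N.-1)%N -> p \is j.-homog ->
    in_powers (p * (\sum_i 'X_i) ^+ k) ->
  in_powers p.
Proof.
elim: k => [|k IHk] lt hp; first by rewrite expr0 mulr1.
rewrite exprS mulrCA => /in_powers_mul_sumX h; apply: IHk => //; first by lia.
apply: (h (j + k)%N); first by lia.
apply: dhomogM => //; rewrite -[k in k.-homog]mul1n.
exact/dhomogMn/sumX_homog.
Qed.

End Lowering.

(** * Apolarity *)

Section DiffOp.
Variables (n : nat) (K : numFieldType).
Implicit Types p q f g l : {mpoly K[n]}.

(** The apolarity action: ['X_i] acts as the [i]-th partial derivative. *)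
Definition diffop p f : {mpoly K[n]} := \sum_(m <- msupp p) p@_m *: f^`M[m].

Lemma diffopwE k p f : (msize p <= k)%N ->
  diffop p f = \sum_(m : 'X_{1..n < k}) p@_m *: f^`M[m].
Proof.
move=> lek; rewrite /diffop (big_mksub 'X_{1..n < k}) //=; first last.
- by move=> m /msize_mdeg_lt /leq_trans; apply.
- exact: msupp_uniq.
by rewrite big_rmcond //= => i /memN_msupp_eq0 ->; rewrite scale0r.
Qed.

Lemma diffop_is_linear_l f : linear (diffop ^~ f).
Proof.
move=> a p q; pose k := maxn (msize (a *: p + q)) (maxn (msize p) (msize q)).
rewrite !(@diffopwE k) /k ?leq_max ?leqnn ?orbT // scaler_sumr -big_split /=.
by apply: eq_bigr => m _; rewrite mcoeffD mcoeffZ scalerDl scalerA.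
Qed.

Lemma diffop_is_linear p : linear (diffop p).
Proof.
move=> a f g; rewrite /diffop scaler_sumr -big_split /=; apply: eq_bigr => m _.
by rewrite mderivmD mderivmZ scalerDr !scalerA mulrC.
Qed.

HB.instance Definition _ p :=
  GRing.isLinear.Build K {mpoly K[n]} {mpoly K[n]} _ (diffop p)
    (diffop_is_linear p).

(** The arguments are swapped so that linearity in the operator can be registered too. *)
Definition diffop_of f p := diffop p f.

HB.instance Definition _ f :=
  GRing.isLinear.Build K {mpoly K[n]} {mpoly K[n]} _ (diffop_of f)
    (diffop_is_linear_l f).

Lemma diffopX m f : diffop 'X_[m] f = f^`M[m].
Proof. by rewrite /diffop msuppX big_seq1 mcoeffX eqxx scale1r. Qed.

Lemma diffopM p q f : diffop (p * q) f = diffop p (diffop q f).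
Proof.
rewrite -[LHS]/(diffop_of f (p * q)) {1}[p]mpolyE mulr_suml linear_sum.
apply: eq_bigr => m _; rewrite -scalerAl linearZ; congr (_ *: _).
rewrite {1}[q]mpolyE mulr_sumr linear_sum [X in _ = X^`M[_]]/diffop linear_sum.
apply: eq_bigr => m' _; rewrite -scalerAr !linearZ; congr (_ *: _).
rewrite -[LHS]/(diffop ('X_[m] * 'X_[m']) f) -mpolyXD diffopX addmC.
exact: mderivmDm.
Qed.

Lemma diffop_linM l f g : l \is 1.-homog ->
  diffop l (f * g) = diffop l f * g + f * diffop l g.
Proof.
move=> /dhomogP hl; rewrite /diffop mulr_suml mulr_sumr -big_split /=.
rewrite !big_seq; apply: eq_bigr => m /hl /eqP /mdeg1P [i /eqP ->].
by rewrite !mderivmU1m mderivM scalerDr scalerAl scalerAr.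
Qed.

Lemma diffop_lin_homog l d f : l \is 1.-homog -> f \is d.+1.-homog ->
  diffop l f \is d.-homog.
Proof.
move=> /dhomogP hl hf; rewrite /diffop big_seq; apply: rpred_sum => m.
move=> /hl /eqP /mdeg1P [i /eqP ->]; rewrite mderivmU1m.
by apply/rpredZ/mderiv_homog.
Qed.

Lemma diffop_lin1 l : l \is 1.-homog -> diffop l 1 = 0.
Proof.
move=> hl; apply: (addrI (diffop l 1)); rewrite addr0.
by have := diffop_linM 1 1 hl; rewrite !mulr1 mul1r => <-.
Qed.

Lemma diffop_linX l f k : l \is 1.-homog ->
  diffop l (f ^+ k.+1) = diffop l f * f ^+ k *+ k.+1.
Proof.
move=> hl; elim: k => [|k IHk]; first by rewrite mulr1n mulr1.
by rewrite [in LHS]exprS diffop_linM // IHk !exprS; ring.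
Qed.

(* If [l] kills [s] and [l^2] kills [q], then [l] maps [s * q^(k+1)] to a
   multiple of [s' * q^k] with [s' = s * l(q)] again killed by [l]. *)
Lemma diffop_exp_eq0 l s q k : l \is 1.-homog ->
    diffop l s = 0 -> diffop l (diffop l q) = 0 ->
  diffop (l ^+ k.+1) (s * q ^+ k) = 0.
Proof.
move=> hl + lq; elim: k s => [|k IHk] s ls; first by rewrite mulr1.
rewrite exprSr diffopM diffop_linM // ls mul0r add0r diffop_linX //.
rewrite mulrnAr mulrA raddfMn /= IHk ?mul0rn //.
by rewrite diffop_linM // ls lq mul0r mulr0 addr0.
Qed.

End DiffOp.

(** * Quadrics and the failure of surjectivity *)

Section Quadric.
Variables (n : nat) (K : numFieldType).

(** Quadrics form a space of dimension ['C(n.+2, 2)]; the linear form [diffop L q] imposes [n.+1]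
    conditions and each second derivative, being constant, one. *)
Lemma exists_quadric (k : nat) (l : 'I_k -> {mpoly K[n.+1]})
    (L : {mpoly K[n.+1]}) :
    (n.+1 + k < 'C(n.+2, 2))%N -> (forall i, l i \is 1.-homog) ->
    L \is 1.-homog ->
  exists q : {mpoly K[n.+1]}, [/\ q != 0, q \is 2.-homog, diffop L q = 0
    & forall i, diffop (l i) (diffop (l i) q) = 0].
Proof.
move=> ltd hl hL.
pose f (u : dhomog n.+1 K 2) : dhomog n.+1 K 1 * {ffun 'I_k -> K^o} :=
  (hproj 1 (diffop L (val u)),
   [ffun i => (diffop (l i) (diffop (l i) (val u)))@_0%MM]).
have flin : linear f.
  move=> a u v; congr (_, _).
    by apply/val_inj; rewrite /= !linearP.
  by apply/ffunP => i; rewrite !ffunE /= !linearP.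
pose F : {linear _ -> _} := HB.pack f (GRing.isLinear.Build _ _ _ _ f flin).
have : lker (linfun F) != 0%VS.
  apply/negP => /eqP k0; have := limg_ker_dim (linfun F) fullv.
  rewrite k0 capv0 dimv0 add0n dimvf => dE.
  have := dimvS (subvf (limg (linfun F))); rewrite dE dimvf.
  rewrite /dim /= /dim /= card_ord muln1 bin1 add1n add2n leqNgt.
  exact/negP/negPn.
rewrite -vpick0; set u := vpick _ => u0.
have : u \in lker (linfun F) by exact: memv_pick.
rewrite memv_ker lfunE /= => /eqP fu.
have /ffunP lu := congr1 snd fu; move/(congr1 (val \o fst)): fu => /=.
rewrite -[LHS]/(val (hproj 1 _)) val_hproj; last first.
  exact: diffop_lin_homog hL (dhomog_is_dhomog u).
move=> Lu; exists (val u); split=> // [|i].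
- exact: dhomog_is_dhomog.
have h0 : diffop (l i) (diffop (l i) (val u)) \is 0.-homog.
  by do 2![apply: diffop_lin_homog => //]; exact: dhomog_is_dhomog.
apply/mpolyP => m; rewrite mcoeff0; have [->|nz] := eqVneq m 0%MM.
  by have := lu i; rewrite !ffunE.
by rewrite (dhomog_coeff0 h0) // mdeg_eq0.
Qed.

(** All of [(L)] plus the ideal kills [q ^+ N], whereas a monomial of its support does not; the
    leading one serves as [w]. *)
Lemma powers_not_surj (ls : seq {mpoly K[n.+1]}) (N : nat)
    (L : {mpoly K[n.+1]}) :
    (n.+1 + size ls < 'C(n.+2, 2))%N -> {in ls, forall l, l \is 1.-homog} ->
    L \is 1.-homog ->
  exists2 w : {mpoly K[n.+1]}, w \is (2 * N).-homog &
    forall p, w - L * p \notin gen_ideal [seq l ^+ N.+1 | l <- ls].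
Proof.
move=> ltd hls hL.
have hl (i : 'I_(size ls)) : ls`_i \is 1.-homog by apply/hls/mem_nth.
have [q [q0 q2 Lq lq]] := exists_quadric ltd hl hL.
have F0 : q ^+ N != 0 by rewrite expf_eq0 (negPf q0) andbF.
pose m := mlead (q ^+ N); have mF : m \in msupp (q ^+ N) by exact: mlead_supp.
have LF : diffop L (q ^+ N) = 0.
  case: (N) => [|k]; first exact: diffop_lin1.
  by rewrite diffop_linX // Lq mul0r mul0rn.
exists 'X_[m].
  rewrite dhomogX; apply/eqP; exact: (dhomog_mf (dhomogMn N q2)) mF.
move=> p; apply/negP => /asboolP[c wE].
have : diffop 'X_[m] (q ^+ N) = 0.
  rewrite -[LHS]/(diffop_of (q ^+ N) _) -['X_[m]](subrK (L * p)) wE.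
  rewrite raddfD raddf_sum /= /diffop_of mulrC diffopM LF raddf0 addr0.
  apply: big1 => i _; rewrite diffopM.
  have ils : (i < size ls)%N.
    by have := ltn_ord i; rewrite [X in (_ < X)%N]size_map.
  rewrite (nth_map 0) // -[q ^+ N]mul1r diffop_exp_eq0 ?raddf0 //.
  - exact: (hl (Ordinal ils)).
  - by apply: diffop_lin1; exact: (hl (Ordinal ils)).
  - exact: (lq (Ordinal ils)).
(* The constant term is the coefficient of [q ^+ N] at [m] times the factorials of the exponents,
   nonzero in characteristic 0. *)
rewrite diffopX => /(congr1 (mcoeff 0%MM)).
rewrite mcoeff_mderivm addm0 mcoeff0; apply/eqP.
rewrite mulrn_eq0 mcoeff_eq0 mF orbF -lt0n prodn_gt0 // => i.
by rewrite ffact_gt0.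
Qed.

End Quadric.

(** * Powers of the variables and of their sum *)

Definition linear_forms (n : nat) (K : nzRingType) : seq {mpoly K[n]} :=
  rcons [seq 'X_i | i <- enum 'I_n] (\sum_i 'X_i).

Lemma linear_forms_homog n (K : numFieldType) :
  {in linear_forms n K, forall l, l \is 1.-homog}.
Proof.
move=> l; rewrite mem_rcons inE => /predU1P [->|/mapP [i _ ->]].
  exact: sumX_homog.
exact: mpolyX_homog.
Qed.

Lemma size_linear_forms n (K : nzRingType) : size (linear_forms n K) = n.+1.
Proof. by rewrite size_rcons size_map size_enum_ord. Qed.

(** For [k != i] the exponent of ['X_k] in this monomial is at most [e < N], so the summand of [k]
    cannot contribute. *)
Lemma mcoeff_sum_mulXn n (K : numFieldType) N e (c : 'I_n -> {mpoly K[n]})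
    (i : 'I_n) (m : 'X_{1..n}) :
    (e < N)%N -> mdeg m = e ->
  (\sum_k c k * 'X_k ^+ N)@_(m + U_(i) *+ N) = (c i)@_m.
Proof.
move=> eN me; rewrite raddf_sum /= (bigD1 i) //= mpolyXn addmC mcoeffMX.
rewrite [X in _ + X]big1 ?addr0 // => k ne.
rewrite mpolyXn mcoeffMX_eq0 //; apply/negP => /mnm_lepP /(_ k).
rewrite mnmDE !mulmnE !mnm1E eqxx eq_sym (negPf ne) mul1n mul0n add0n leqNgt.
by rewrite (leq_ltn_trans _ eN) // -me mdegE (bigD1 k) //= leq_addr.
Qed.

(** Modulo the ['X_i ^+ N] only the last summand survives; its coefficient then lies in the monomial
    ideal and vanishes, having degree below [N]. Comparing coefficients kills the others. *)
Lemma powers_free n (K : numFieldType) (N e : nat)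
    (gens := [seq l ^+ N | l <- linear_forms n K])
    (c : 'I_(size gens) -> {mpoly K[n]}) :
    (e < N)%N -> ((e + N.-1).*2 < n * N.-1)%N ->
    (forall i, c i \is e.-homog) -> \sum_i c i * gens`_i = 0 ->
  forall i, c i = 0.
Proof.
move=> eN eNn hc c0.
have sz : size gens = n.+1 by rewrite size_map size_linear_forms.
(* Extending [c] by zero to all naturals lets the sum be reindexed through [sz] and its last term
   split off. *)
pose d k := oapp c 0 (insub k).
have dE (i : 'I_(size gens)) : d i = c i by rewrite /d valK.
have hd k : d k \is e.-homog.
  by rewrite /d; case: insubP => [i _ _|_] /=; [exact: hc | exact: rpred0].
have gX (i : 'I_n) : gens`_i = 'X_i ^+ N.
  rewrite (nth_map 0) ?size_linear_forms 1?ltnW ?ltnS ?ltn_ord //.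
  rewrite nth_rcons size_map size_enum_ord ltn_ord.
  by rewrite (nth_map i) ?size_enum_ord // nth_ord_enum.
have gS : gens`_n = (\sum_i 'X_i) ^+ N.
  rewrite (nth_map 0) ?size_linear_forms // nth_rcons size_map size_enum_ord.
  by rewrite ltnn eqxx.
have sum0 : \sum_(i < n) d i * 'X_i ^+ N + d n * (\sum_i 'X_i) ^+ N = 0.
  rewrite -[RHS]c0 -gS (eq_bigr (fun i : 'I_n => d i * gens`_i)); last first.
    by move=> i _; rewrite gX.
  rewrite (eq_bigr (fun i : 'I_(size gens) => d i * gens`_i)); last first.
    by move=> i _; rewrite dE.
  rewrite -(big_mkord xpredT (fun k => d k * gens`_k)).
  rewrite -(big_mkord xpredT (fun k => d k * gens`_k)).
  by rewrite sz big_nat_recr.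
have dn0 : d n = 0.
  apply: (in_powers_small eN (hd n)).
  apply: (in_powers_mul_sumXn (k := N) eNn (hd n)).
  move/eqP: sum0; rewrite addrC addr_eq0 => /eqP ->.
  apply: in_powersN; elim/big_rec: _ => [m _|i p _ ip]; first exact: mcoeff0.
  by apply: in_powersD ip; apply: in_powers_mulXn.
have dX (i : 'I_n) : d i = 0.
  apply/mpolyP => m; rewrite mcoeff0.
  have [me|ne] := eqVneq (mdeg m) e; last exact: dhomog_coeff0 (hd i) ne.
  rewrite -(mcoeff_sum_mulXn (fun k => d (val k)) i eN me) /=.
  by move: sum0; rewrite dn0 mul0r addr0 => ->; rewrite mcoeff0.
move=> i; rewrite -dE; have : (i < n.+1)%N by rewrite -[X in (_ < X)%N]sz.
by rewrite ltnS leq_eqVlt => /predU1P [->//|lt]; exact: (dX (Ordinal lt)).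
Qed.

(** * From the quotient to the ideal, and the final count *)

Lemma quot_mul_injective (n : nat) (K : fieldType) (gens : seq {mpoly K[n]})
    L j p :
    set_inj (@graded_part K n gens j) (quot_mul L) ->
    p \is j.-homog -> L * p \in gen_ideal gens ->
  p \in gen_ideal gens.
Proof.
move=> inj hp Lp.
have E q : (q \in gen_ideal gens) =
    (\pi_(quot_by gens) q == \pi_(quot_by gens) 0).
  by rewrite -Quotient.idealrBE subr0.
rewrite E; apply/eqP/inj.
- by apply: mem_set; exists p.
- by apply: mem_set; exists 0 => //=; exact: rpred0.
by rewrite !quot_mulE mulr0; apply/eqP; rewrite -E.
Qed.

Lemma quot_mul_surjective (n : nat) (K : fieldType) (gens : seq {mpoly K[n]})
    L j w :
    set_surj (@graded_part K n gens j) (@graded_part K n gens j.+1)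
      (quot_mul L) ->
    w \is j.+1.-homog ->
  exists p, w - L * p \in gen_ideal gens.
Proof.
move=> surj hw; have [|_ [p _ <-] /esym/eqP] := surj (\pi_(quot_by gens) w).
  by exists w.
by rewrite quot_mulE -Quotient.idealrBE; exists p.
Qed.

(** Pascal's rule reduces this to ['C(j + 3, 2) <= 5 * 'C(e + 3, 2)], where [e + 3] is [N] and
    [j + 3] is [2N]. *)
Lemma binomial_count (e j : nat) : j = (e.+3 + e)%N ->
  ('C(j.+1 + 3, j.+1) + 5 * 'C(e + 3, e) <=
   'C(j + 3, j) + 5 * 'C(e.+1 + 3, e.+1))%N.
Proof.
move=> jE; have binE m : 'C(m + 3, m) = 'C(m + 3, 3).
  by have := bin_sub (leq_addl m 3); rewrite addnK => ->.
have h2 m : (m.+1 * m = 2 * 'C(m.+1, 2))%N by rewrite -mul_bin_diag bin1.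
rewrite !binE !addSn (binS (j + 3)) (binS (e + 3)) !addn3.
have := h2 (e + 2)%N; have := h2 (j + 2)%N; rewrite !addn2 jE; nia.
Qed.

Theorem proposition5p3 (R : realType) (N : nat) (hN : (3 <= N)%N) :
  @fails_WLP (complex R) 4
    (rcons [seq 'X_i ^+ N | i <- enum 'I_4] ((\sum_(i < 4) 'X_i) ^+ N))
    (2 * N - 3).
Proof.
set gens := rcons _ _.
have gE : gens = [seq l ^+ N | l <- linear_forms 4 (complex R)].
  by rewrite map_rcons -map_comp.
have hg (i : 'I_(size gens)) : gens`_i \is N.-homog.
  have : gens`_i \in gens by rewrite mem_nth.
  move: (gens`_i) => g; rewrite gE => /mapP [l ll ->].
  by rewrite -[N in N.-homog]mul1n; apply/dhomogMn/linear_forms_homog.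
have sz : size gens = 5 by rewrite gE size_map size_linear_forms.
(* Coefficients of the generators have degree [e] in degree [2N - 3] and [e.+1] in degree
   [2N - 2]. *)
have [e NE] : exists e, N = e.+3 by exists (N - 3)%N; lia.
have jE : (2 * N - 3 = N + e)%N by lia.
rewrite jE => L hL.
have homogl := @linear_forms_homog 4 (complex R).
(* The numerical hypothesis reads [4 + 5 < 10]. *)
have [|w hw nw] := powers_not_surj N.-1 _ homogl hL.
  by rewrite size_linear_forms.
have N0 : (0 < N)%N by lia.
rewrite (prednK N0) -gE in nw.
have {}hw : w \is (N + e).+1.-homog.
  by have -> : ((N + e).+1 = 2 * N.-1)%N by lia.
case=> [inj|surj]; last first.
  by have [p] := quot_mul_surjective surj hw; rewrite (negPf (nw p)).
have free (c : 'I_(size gens) -> {mpoly (complex R)[4]}) :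
    (forall i, c i \is e.+1.-homog) -> \sum_i c i * gens`_i = 0 ->
    forall i, c i = 0.
  (* Cancelling the [N] factors starts in degree [2N - 3], just below the middle degree [2N - 2]. *)
  by move: c; rewrite gE => c; apply: powers_free; lia.
have := injective_mul_dim hg hL free (fun p => quot_mul_injective inj) hw nw.
by rewrite sz NE ltnNge binomial_count.
Qed.
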